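(* Let $\ell\in\mathbb{Z}$ and $m\in\{0,1,2,\ldots\}$ with $m\ge\ell$. For all $x\in\mathbb{R}$, $x\neq0$, $$H^{(1)}\!\left(\left.\begin{array}{c}m+1-\ell\\ 2(m+1)-\ell\end{array}\right|x\right)=(2m-\ell+1)\binom{2m-\ell}{m}\Big\{(-1)^{m-\ell}x^{\ell-2m-1}\left(H_{2m-\ell+1}-H_m\right)\left[e^{x}\mathcal{P}(-\ell,m-\ell,-x)-\mathcal{P}(\ell,m,x)\right]+e^{x}\mathcal{F}(-\ell,m-\ell,-x)\Big\}.$$
   Context: $H^{(1)}\!\left(\left.\begin{array}{c}a\\ b\end{array}\right|x\right)=\frac{\partial}{\partial b}\left[{}_1F_1(a;b;x)\right]$ is the derivative of the Kummer confluent hypergeometric function with respect to its second parameter. $H_n=\sum_{k=1}^n\frac1k$ ($H_0=0$) are harmonic numbers. For integers $s,k$ with $k\ge0$ and $k\ge s$, $$\mathcal{P}(s,k,z)=\sum_{n=0}^{k}\binom{k}{n}(2k-s-n)!\,z^n,\qquad \mathcal{F}(s,k,z)=\sum_{n=0}^{k}(-1)^n\binom{k}{n}\frac{d^{\,n+k-s}}{dz^{\,n+k-s}}\left[\frac{\ln z-\mathrm{Chi}(z)-\mathrm{Shi}(z)+\gamma}{z}\right],$$ where $\gamma$ is Euler's constant, $\mathrm{Shi}(z)=\int_0^z\frac{\sinh t}{t}dt$ and $\mathrm{Chi}(z)=\gamma+\ln z+\int_0^z\frac{\cosh t-1}{t}dt$ (same branch of $\ln z$ in both places, so the bracket is an entire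 function of $z$). *)

(* Defs.v *)
From Stdlib Require Export Reals ZArith.
From Coquelicot Require Export Coquelicot.
Open Scope R_scope.

(** Real-variable setting: Stdlib's [R] with Coquelicot's total operators. *)

Fixpoint pochhammer (a : R) (n : nat) : R :=
  match n with
  | O => 1
  | S p => pochhammer a p * (a + INR p)
  end.

Definition kummer (a b x : R) : R :=
  PSeries (fun n => pochhammer a n / (pochhammer b n * INR (fact n))) x.

Definition H1 (a b x : R) : R := Derive (fun b' => kummer a b' x) b.

(** The sum is empty for [n = 0]. *)
Definition harmonic (n : nat) : R := sum_n_m (fun k => / INR k) 1 n.

Definition euler_gamma : R :=
  real (Lim_seq (fun n => harmonic n - ln (INR n))).

Definition Shi (z : R) : R := RInt (fun t => sinh t / t) 0 z.

(** The logarithm on the nonzero reals is taken to be [ln |z|].  On the negative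
    axis a complex branch of [ln z] differs from it by a constant [i (2 j + 1) pi],
    which occurs both in [ln z] and in [Chi z] and so cancels in [bracket]. *)
Definition Chi (z : R) : R :=
  euler_gamma + ln (Rabs z) + RInt (fun t => (cosh t - 1) / t) 0 z.

(** On [z <> 0] this is the restriction of an entire function; the removable
    singularity at [z = 0] is not filled in, so [calF] is meaningful only at
    nonzero points. *)
Definition bracket (z : R) : R :=
  (ln (Rabs z) - Chi z - Shi z + euler_gamma) / z.

(** In [calP] and [calF] the integer [s] satisfies [s <= k], so that the
    arguments of [Z.to_nat] are nonnegative.  [Binomial.C] is the binomial
    coefficient ([C] alone is Coquelicot's type of complex numbers). *)
Definition calP (s : Z) (k : nat) (z : R) : R :=
  sum_n (fun n => Binomial.C k n
                  * INR (fact (Z.to_nat (2 * Z.of_nat k - s - Z.of_nat n)))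
                  * z ^ n) k.

Definition calF (s : Z) (k : nat) (z : R) : R :=
  sum_n (fun n => (-1) ^ n * Binomial.C k n
                  * Derive_n bracket (Z.to_nat (Z.of_nat n + Z.of_nat k - s)) z) k.

(* Main.v *)
Require Import Defs.
From Stdlib Require Import Reals ZArith Lra Lia.
From Coquelicot Require Import Coquelicot.
Open Scope R_scope.

(** Put [p = m - l], so that the parameters are [a = p + 1], [b = p + m + 2].
    Differentiating the Kummer series term by term in [b] gives a combination
    of [K(p,m) = \int_0^1 e^(x t) t^p (1-t)^m dt] and
    [G(p,m) = \int_0^1 e^(x t) t^p (1-t)^m ln(1-t) dt], both handled as power
    series in [x] whose coefficients are explicit moments.  Multiplying the
    integrand by [t] is differentiation in [x], and multiplying it by [1 - t]
    gives [f(p,m+1) = f(p,m) - f(p+1,m)].  A family satisfying both relations on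
    [x <> 0] is determined by [f(0,0)].  The sums [calP] and [calF], multiplied by
    the factors they carry in the formula, satisfy the same relations by Pascal's
    rule, so only [p = m = 0] has to be checked: [K(0,0) = (e^x - 1) / x], and
    [G(0,0) = e^x bracket(-x)], which amounts to the expansion of
    [- e^x \int_0^(-x) (e^t - 1) / t dt] as [\sum_n H_n x^n / n!]. *)

(** * Entire power series and exponential generating functions *)

Lemma INR_fact_S (n : nat) : INR (fact (S n)) = INR (S n) * INR (fact n).
Proof. rewrite fact_simpl, mult_INR; reflexivity. Qed.

Lemma ex_series_exp_dominated (u : nat -> R) (K t : R) :
  (forall n, Rabs (u n) <= K * (t ^ n / INR (fact n))) -> ex_series u.
Proof.
intros Hu.
apply (ex_series_le (K := R_AbsRing) (V := R_CompleteNormedModule) u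
         (fun n => K * (t ^ n / INR (fact n)))).
- exact Hu.
- apply (ex_series_scal_l (K := R_AbsRing) K (fun n => t ^ n / INR (fact n))).
  exists (exp t).
  apply is_series_ext with (2 := is_exp_Reals t).
  intros n; unfold scal; simpl; unfold mult; simpl.
  rewrite pow_n_pow; reflexivity.
Qed.

Definition entire (a : nat -> R) : Prop := CV_radius a = p_infty.

(** Comparison with an exponential series gives convergence at every real [r], which no finite
    radius allows. *)
Lemma entire_exp_dominated (a : nat -> R) (K M : R) :
  (forall n, Rabs (a n) <= K * (M ^ n / INR (fact n))) -> entire a.
Proof.
intros Ha.
assert (Hr : forall r : R, Rbar_le r (CV_radius a)).
{ intros r; apply (proj1 (Lub_Rbar_correct (CV_disk a))).
  apply (ex_series_exp_dominated _ K (M * Rabs r)); intros n.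
  rewrite Rabs_Rabsolu, Rabs_mult, <- RPow_abs, Rpow_mult_distr.
  pose proof (Rmult_le_compat_r (Rabs r ^ n) _ _
    (pow_le _ n (Rabs_pos r)) (Ha n)) as H.
  unfold Rdiv in *; nra. }
unfold entire; destruct (CV_radius a) as [r | |] eqn:E.
- specialize (Hr (r + 1)); simpl in Hr; lra.
- reflexivity.
- destruct (Hr 0).
Qed.

Lemma entire_inside (a : nat -> R) (x : R) :
  entire a -> Rbar_lt (Rabs x) (CV_radius a).
Proof. intros E; rewrite E; exact I. Qed.

Lemma entire_ex_pseries (a : nat -> R) (x : R) : entire a -> ex_pseries a x.
Proof. intros E; apply CV_radius_inside, entire_inside, E. Qed.

(** If [c] is the moment sequence of a measure mu, this is \int e^(x t) dmu(t); differentiation in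
    [x] is then the shift of [c]. *)
Definition egf (c : nat -> R) (x : R) : R :=
  PSeries (fun n => c n / INR (fact n)) x.

Lemma egf_ext (c d : nat -> R) (x : R) : (forall n, c n = d n) -> egf c x = egf d x.
Proof. intros E; apply PSeries_ext; intros n; rewrite E; reflexivity. Qed.

Lemma entire_egf (c : nat -> R) (K M : R) :
  (forall n, Rabs (c n) <= K * M ^ n) -> entire (fun n => c n / INR (fact n)).
Proof.
intros Hc; apply (entire_exp_dominated _ K M); intros n.
pose proof (INR_fact_lt_0 n) as Hf.
unfold Rdiv; rewrite Rabs_mult, <- Rmult_assoc.
rewrite (Rabs_pos_eq (/ _)) by (left; apply Rinv_0_lt_compat, Hf).
apply Rmult_le_compat_r; [left; apply Rinv_0_lt_compat, Hf | apply Hc].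
Qed.

Lemma is_derive_egf (c : nat -> R) (x : R) :
  entire (fun n => c n / INR (fact n)) ->
  is_derive (egf c) x (egf (fun n => c (S n)) x).
Proof.
intros E.
replace (egf (fun n => c (S n)) x)
  with (PSeries (PS_derive (fun n => c n / INR (fact n))) x).
- apply is_derive_PSeries, entire_inside, E.
- apply PSeries_ext; intros n; unfold PS_derive.
  rewrite INR_fact_S.
  field; split; [apply INR_fact_neq_0 | apply not_0_INR; lia].
Qed.

Lemma egf_linear (k l : R) (c d : nat -> R) (x : R) :
  entire (fun n => c n / INR (fact n)) -> entire (fun n => d n / INR (fact n)) ->
  egf (fun n => k * c n + l * d n) x = k * egf c x + l * egf d x.
Proof.
intros Ec Ed; unfold egf.
rewrite <- (PSeries_scal k), <- (PSeries_scal l).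
rewrite <- PSeries_plus.
- apply PSeries_ext; intros n; unfold PS_plus, PS_scal, plus, scal; simpl.
  unfold mult; simpl; unfold Rdiv; ring.
- apply ex_pseries_scal; [apply Rmult_comm | apply entire_ex_pseries, Ec].
- apply ex_pseries_scal; [apply Rmult_comm | apply entire_ex_pseries, Ed].
Qed.

Lemma egf_decr (c : nat -> R) (x : R) :
  entire (fun n => c n / INR (fact n)) ->
  egf c x = c O + x * egf (fun n => c (S n) / INR (S n)) x.
Proof.
intros E; unfold egf; rewrite PSeries_decr_1 by (apply entire_ex_pseries, E).
f_equal; [simpl; field | f_equal; apply PSeries_ext; intros n].
unfold PS_decr_1; rewrite INR_fact_S.
field; split; [apply not_0_INR; lia | apply INR_fact_neq_0].
Qed.

Lemma egf_0 (c : nat -> R) : egf c 0 = c O.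
Proof. unfold egf; rewrite PSeries_0; simpl; field. Qed.

Lemma egf_1 (x : R) : egf (fun _ => 1) x = exp x.
Proof.
unfold egf; rewrite exp_Reals.
apply PSeries_ext; intros n; unfold Rdiv; ring.
Qed.

Lemma egf_continuous (c : nat -> R) (x : R) :
  entire (fun n => c n / INR (fact n)) -> continuous (egf c) x.
Proof.
intros E; apply (ex_derive_continuous (V := R_NormedModule)).
eexists; apply is_derive_egf, E.
Qed.

(** * Families closed under multiplication of the integrand by t and 1 - t *)

(** The relations satisfied by [f p m x = \int e^(x t) t^p (1-t)^m dmu(t)]. *)
Definition contiguous (f : nat -> nat -> R -> R) : Prop :=
  forall p m x, x <> 0 ->
    is_derive (f p m) x (f (S p) m x) /\
    f p (S m) x = f p m x - f (S p) m x.

Lemma locally_neq_0 (x : R) : x <> 0 -> locally x (fun y => y <> 0).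
Proof.
intros Hx; assert (H : 0 < Rabs x) by (apply Rabs_pos_lt; exact Hx).
exists (mkposreal _ H); intros y Hy Hy0; revert Hy; rewrite Hy0.
unfold ball; simpl; unfold AbsRing_ball, minus, plus, opp, abs; simpl.
rewrite Rplus_0_l, Rabs_Ropp; lra.
Qed.

(** At fixed [m] the derivative relation carries agreement from [p] to [p + 1], because agreement
    holds in a neighbourhood of each nonzero point. The difference relation at [p = 0] then carries
    it from [m] to [m + 1]. *)
Lemma contiguous_unique (f g : nat -> nat -> R -> R) :
  contiguous f -> contiguous g ->
  (forall x, x <> 0 -> f O O x = g O O x) ->
  forall m p x, x <> 0 -> f p m x = g p m x.
Proof.
intros Hf Hg H0.
assert (Hp : forall m, (forall x, x <> 0 -> f O m x = g O m x) ->
               forall p x, x <> 0 -> f p m x = g p m x).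
{ intros m Hm p; induction p as [|p IH]; [exact Hm | intros x Hx].
  rewrite <- (is_derive_unique _ _ _ (proj1 (Hf p m x Hx))).
  rewrite <- (is_derive_unique _ _ _ (proj1 (Hg p m x Hx))).
  apply Derive_ext_loc.
  apply (filter_imp (fun y => y <> 0)); [exact IH | apply locally_neq_0, Hx]. }
induction m as [|m IH]; apply Hp; [exact H0 | intros x Hx].
rewrite (proj2 (Hf O m x Hx)), (proj2 (Hg O m x Hx)), !IH by exact Hx; reflexivity.
Qed.

Lemma contiguous_plus (f g : nat -> nat -> R -> R) :
  contiguous f -> contiguous g -> contiguous (fun p m x => f p m x + g p m x).
Proof.
intros Hf Hg p m x Hx; destruct (Hf p m x Hx) as [Df Ef], (Hg p m x Hx) as [Dg Eg].
split; [apply (is_derive_plus (V := R_NormedModule)); assumption |].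
rewrite Ef, Eg; ring.
Qed.

(** Each step in [j] subtracts two earlier weights, so the bound at most doubles and |w i j| <=
    2^j. *)
Lemma entire_contiguous_weight (w : nat -> nat -> R) :
  (forall i j, w i (S j) = w i j - w (S i) j) ->
  (forall i, Rabs (w i O) <= 1) ->
  forall p m, entire (fun n => w (p + n)%nat m / INR (fact n)).
Proof.
intros Hw H0.
assert (Hb : forall j i, Rabs (w i j) <= 2 ^ j).
{ induction j as [|j IH]; intros i; [apply H0 |].
  rewrite Hw; unfold Rminus; eapply Rle_trans; [apply Rabs_triang |].
  rewrite Rabs_Ropp; simpl; pose proof (IH i); pose proof (IH (S i)); lra. }
intros p m; apply (entire_egf _ (2 ^ m) 1); intros n.
rewrite pow1, Rmult_1_r; apply Hb.
Qed.

Lemma contiguous_egf (w : nat -> nat -> R) :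
  (forall i j, w i (S j) = w i j - w (S i) j) ->
  (forall i, Rabs (w i O) <= 1) ->
  contiguous (fun p m => egf (fun n => w (p + n)%nat m)).
Proof.
intros Hw H0; pose proof (entire_contiguous_weight w Hw H0) as E.
intros p m x Hx; split.
- replace (egf (fun n => w (S p + n)%nat m) x)
    with (egf (fun n => w (p + S n)%nat m) x).
  + apply (is_derive_egf (fun n => w (p + n)%nat m)), E.
  + apply egf_ext; intros n; rewrite Nat.add_succ_r; reflexivity.
- replace (egf (fun n => w (p + n)%nat m) x - egf (fun n => w (S p + n)%nat m) x)
    with (1 * egf (fun n => w (p + n)%nat m) x
          + -1 * egf (fun n => w (S p + n)%nat m) x) by ring.
  rewrite <- egf_linear by apply E.
  apply egf_ext; intros n; rewrite Hw; simpl; ring.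
Qed.

(** * Alternating binomial sums of derivatives *)

(** This is (1 - S)^p [u] at index 0, where S is the shift of sequences. *)
Definition alt_binomial (p : nat) (u : nat -> R) : R :=
  sum_n (fun n => (-1) ^ n * Binomial.C p n * u n) p.

Lemma alt_binomial_S (p : nat) (u : nat -> R) :
  alt_binomial (S p) u = alt_binomial p u - alt_binomial p (fun n => u (S n)).
Proof.
(* Partial sums are used because [Binomial.C p (S p)] is not 0. Pascal's rule leaves one boundary
   term, which at [N = p] cancels the top term of the longer sum. *)
assert (H : forall N, (N <= p)%nat ->
  sum_n (fun n => (-1) ^ n * Binomial.C (S p) n * u n) N =
  sum_n (fun n => (-1) ^ n * Binomial.C p n * u n) N
  - sum_n (fun n => (-1) ^ n * Binomial.C p n * u (S n)) N
  + (-1) ^ N * Binomial.C p N * u (S N)).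
{ induction N as [|N IH]; intros HN.
  - rewrite !sum_O, !C_n_0; simpl; ring.
  - rewrite !sum_Sn, IH by lia; unfold plus; simpl.
    rewrite <- (pascal p N) by lia; ring. }
unfold alt_binomial; rewrite sum_Sn, H by lia; unfold plus; simpl.
rewrite !C_n_n; ring.
Qed.

Lemma alt_binomial_ext (p : nat) (u v : nat -> R) :
  (forall n, u n = v n) -> alt_binomial p u = alt_binomial p v.
Proof. intros E; apply sum_n_ext; intros n; rewrite E; reflexivity. Qed.

Lemma is_derive_alt_binomial (p : nat) (u : nat -> R -> R) (d : nat -> R) (x : R) :
  (forall n, is_derive (u n) x (d n)) ->
  is_derive (fun y => alt_binomial p (fun n => u n y)) x (alt_binomial p d).
Proof.
intros H; unfold alt_binomial.
apply (is_derive_sum_n (V := R_NormedModule)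
         (fun n y => (-1) ^ n * Binomial.C p n * u n y) p x); intros k _.
apply (is_derive_scal (u k)), H.
Qed.

Definition derivative_chain (g : nat -> R -> R) : Prop :=
  forall k x, x <> 0 -> is_derive (g k) x (g (S k) x).

(** With D = d/dx the family is (1 - D)^m D^p applied to [g 0], so D raises [p] and 1 - D raises
    [m]. *)
Lemma contiguous_alt_binomial (g : nat -> R -> R) :
  derivative_chain g ->
  contiguous (fun p m x => alt_binomial m (fun n => g (n + p)%nat x)).
Proof.
intros Hg p m x Hx; split.
- apply is_derive_alt_binomial; intros n.
  rewrite Nat.add_succ_r; apply Hg, Hx.
- rewrite alt_binomial_S; f_equal.
  apply alt_binomial_ext; intros n; f_equal; lia.
Qed.

(** For h = (1 - D)^p D^m (g 0), the derivative of e^x h(-x) is e^x ((1 - D) h)(-x), which raises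
    [p]. Subtracting it from e^x h(-x) leaves e^x (D h)(-x), which raises [m]. *)
Lemma contiguous_exp_alt_binomial (g : nat -> R -> R) :
  derivative_chain g ->
  contiguous (fun p m x => exp x * alt_binomial p (fun n => g (n + m)%nat (- x))).
Proof.
intros Hg p m x Hx; split.
- assert (H : is_derive (fun y => alt_binomial p (fun n => g (n + m)%nat (- y))) x
                (alt_binomial p (fun n => (-1) * g (S n + m)%nat (- x)))).
  { apply (is_derive_alt_binomial p (fun n y => g (n + m)%nat (- y))); intros n.
    apply (is_derive_comp (g (n + m)%nat) Ropp); [apply Hg; lra |].
    auto_derive; [exact I | reflexivity]. }
  rewrite alt_binomial_S.
  replace (exp x * _) with
    (exp x * alt_binomial p (fun n => g (n + m)%nat (- x)) +
     exp x * alt_binomial p (fun n => (-1) * g (S n + m)%nat (- x))).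
  + apply (is_derive_mult exp
             (fun y => alt_binomial p (fun n => g (n + m)%nat (- y))) x (exp x)).
    * apply is_derive_Reals, derivable_pt_lim_exp.
    * exact H.
    * intros; apply Rmult_comm.
  + rewrite <- Rmult_plus_distr_l; f_equal; unfold Rminus; f_equal.
    unfold alt_binomial.
    apply eq_trans with (mult (-1)
      (sum_n (fun n => (-1) ^ n * Binomial.C p n * g (S n + m)%nat (- x)) p : R_Ring)).
    * rewrite <- (sum_n_mult_l (K := R_Ring)); apply sum_n_ext; intros n.
      unfold mult; simpl; ring.
    * unfold mult; simpl; ring.
- rewrite alt_binomial_S.
  rewrite (alt_binomial_ext p (fun n => g (n + S m)%nat (- x))
             (fun n => g (S n + m)%nat (- x))) by (intros n; f_equal; lia).
  ring.
Qed.

(** * Harmonic numbers and Beta moments *)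

Lemma INR_S_pos (n : nat) : 0 < INR (S n).
Proof. apply lt_0_INR; lia. Qed.

Lemma harmonic_S (n : nat) : harmonic (S n) = harmonic n + / INR (S n).
Proof. unfold harmonic; rewrite sum_n_Sm by lia; reflexivity. Qed.

Lemma harmonic_0 : harmonic 0 = 0.
Proof. unfold harmonic; rewrite sum_n_m_zero by lia; reflexivity. Qed.

Lemma Rinv_INR_S_bound (n : nat) : 0 <= / INR (S n) <= 1.
Proof.
split; [left; apply Rinv_0_lt_compat, INR_S_pos |].
rewrite <- Rinv_1; apply Rinv_le_contravar; [lra |].
rewrite S_INR; pose proof (pos_INR n); lra.
Qed.

Lemma harmonic_bound (n : nat) : 0 <= harmonic n <= INR n.
Proof.
induction n as [|n IH]; [rewrite harmonic_0; simpl; lra |].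
rewrite harmonic_S; pose proof (Rinv_INR_S_bound n); rewrite S_INR in *; lra.
Qed.

(** The Beta integral [\int_0^1 t^i (1-t)^j dt]. *)
Definition beta_int (i j : nat) : R :=
  INR (fact i) * INR (fact j) / INR (fact (S (i + j))).

(** The integral [\int_0^1 t^i (1-t)^j ln(1-t) dt]. *)
Definition log_beta_int (i j : nat) : R :=
  - beta_int i j * (harmonic (S (i + j)) - harmonic j).

(** The integrands satisfy t^i (1-t)^(j+1) = t^i (1-t)^j - t^(i+1) (1-t)^j; the check is made on the
    factorial formula. *)
Lemma beta_int_contiguous (i j : nat) :
  beta_int i (S j) = beta_int i j - beta_int (S i) j.
Proof.
unfold beta_int; rewrite Nat.add_succ_r; change (S i + j)%nat with (S (i + j)).
rewrite (INR_fact_S (S (i + j))), (INR_fact_S i), (INR_fact_S j).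
replace (INR (S (S (i + j)))) with (INR i + INR j + 2)
  by (rewrite !S_INR, plus_INR; ring).
rewrite !(S_INR i), !(S_INR j).
pose proof (pos_INR i); pose proof (pos_INR j).
field; split; [apply INR_fact_neq_0 | lra].
Qed.

Lemma log_beta_int_contiguous (i j : nat) :
  log_beta_int i (S j) = log_beta_int i j - log_beta_int (S i) j.
Proof.
unfold log_beta_int, beta_int.
rewrite Nat.add_succ_r; change (S i + j)%nat with (S (i + j)).
rewrite (INR_fact_S (S (i + j))), (INR_fact_S i), (INR_fact_S j).
rewrite (harmonic_S j), (harmonic_S (S (i + j))).
replace (INR (S (S (i + j)))) with (INR i + INR j + 2)
  by (rewrite !S_INR, plus_INR; ring).
rewrite !(S_INR i), !(S_INR j).
pose proof (pos_INR i); pose proof (pos_INR j).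
field; repeat split; try apply INR_fact_neq_0; lra.
Qed.

Lemma beta_int_0_r (i : nat) : beta_int i 0 = / INR (S i).
Proof.
unfold beta_int; rewrite Nat.add_0_r, INR_fact_S; simpl (INR (fact 0)).
field; split; [apply not_0_INR; lia | apply INR_fact_neq_0].
Qed.

Lemma log_beta_int_0_r (i : nat) : log_beta_int i 0 = - (harmonic (S i) / INR (S i)).
Proof.
unfold log_beta_int; rewrite beta_int_0_r, Nat.add_0_r, harmonic_0; unfold Rdiv; ring.
Qed.

Lemma beta_int_0_r_bound (i : nat) : Rabs (beta_int i 0) <= 1.
Proof.
rewrite beta_int_0_r; destruct (Rinv_INR_S_bound i).
rewrite Rabs_pos_eq; assumption.
Qed.

Lemma log_beta_int_0_r_bound (i : nat) : Rabs (log_beta_int i 0) <= 1.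
Proof.
rewrite log_beta_int_0_r, Rabs_Ropp.
destruct (harmonic_bound (S i)); pose proof (INR_S_pos i).
rewrite Rabs_pos_eq.
- apply Rle_div_l; [assumption | rewrite Rmult_1_l; assumption].
- apply Rdiv_le_0_compat; assumption.
Qed.

(** * The exponential integral, the function [bracket] and the generating function of harmonic
    numbers *)

Lemma entire_egf_bounded (c : nat -> R) :
  (forall n, Rabs (c n) <= 1) -> entire (fun n => c n / INR (fact n)).
Proof.
intros Hc; apply (entire_egf c 1 1); intros n; rewrite pow1, Rmult_1_r; apply Hc.
Qed.

Lemma entire_inv_INR : entire (fun n => / INR n / INR (fact n)).
Proof.
apply entire_egf_bounded; intros [|n]; simpl (INR 0).
- rewrite Rinv_0, Rabs_R0; lra.
- destruct (Rinv_INR_S_bound n); rewrite Rabs_pos_eq; assumption.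
Qed.

Lemma entire_inv_INR_S : entire (fun n => / INR (S n) / INR (fact n)).
Proof.
apply entire_egf_bounded; intros n.
destruct (Rinv_INR_S_bound n); rewrite Rabs_pos_eq; assumption.
Qed.

Lemma INR_le_pow2 (n : nat) : INR n <= 2 ^ n.
Proof.
induction n as [|n IH]; [simpl; lra |].
rewrite S_INR; simpl; pose proof (pow_R1_Rle 2 n); lra.
Qed.

Lemma entire_harmonic : entire (fun n => harmonic n / INR (fact n)).
Proof.
apply (entire_egf harmonic 1 2); intros n; rewrite Rmult_1_l.
destruct (harmonic_bound n) as [H0 H1]; rewrite Rabs_pos_eq by exact H0.
apply (Rle_trans _ (INR n)); [exact H1 |].
apply INR_le_pow2.
Qed.

Lemma egf_inv_INR_S (x : R) : x <> 0 -> egf (fun n => / INR (S n)) x = (exp x - 1) / x.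
Proof.
intros Hx.
pose proof (egf_decr (fun _ => 1) x) as H; rewrite egf_1 in H.
rewrite H by (apply entire_egf_bounded; intros _; rewrite Rabs_R1; lra).
rewrite (egf_ext (fun n => 1 / INR (S n)) (fun n => / INR (S n))).
- field; exact Hx.
- intros n; unfold Rdiv; rewrite Rmult_1_l; reflexivity.
Qed.

(** This is \int_0^x (e^t - 1) / t dt, minus the classical Ein at -x. The coefficient at index 0 is
    [/ 0], equal to 0 by convention. *)
Definition Ein (x : R) : R := egf (fun n => / INR n) x.

Lemma is_derive_Ein (x : R) : is_derive Ein x (egf (fun n => / INR (S n)) x).
Proof. apply (is_derive_egf (fun n => / INR n)), entire_inv_INR. Qed.

Lemma Ein_0 : Ein 0 = 0.
Proof. unfold Ein; rewrite egf_0; apply Rinv_0. Qed.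

Lemma is_RInt_Ein (z : R) : is_RInt (fun t => (exp t - 1) / t) 0 z (Ein z).
Proof.
replace (Ein z) with (minus (Ein z) (Ein 0))
  by (rewrite Ein_0; unfold minus, plus, opp; simpl; ring).
(* Agreement is required only strictly between the endpoints, which excludes t = 0. *)
apply (is_RInt_ext (egf (fun n => / INR (S n)))).
- intros t Ht; apply egf_inv_INR_S; intros E; rewrite E in Ht.
  unfold Rmin, Rmax in Ht; destruct (Rle_dec 0 z); lra.
- apply (is_RInt_derive Ein).
  + intros t _; apply is_derive_Ein.
  + intros t _; apply egf_continuous, entire_inv_INR_S.
Qed.

(** Both sinh t / t and (cosh t - 1) / t have this form, with [k = 1/2] and [l = 1/2] or
    [l = -1/2]. *)
Lemma ex_RInt_expm1_comb (k l z : R) :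
  ex_RInt (fun t => k * ((exp t - 1) / t) + l * ((exp (- t) - 1) / (- t))) 0 z.
Proof.
apply (ex_RInt_plus (V := R_NormedModule)).
- apply (ex_RInt_scal (V := R_NormedModule)); eexists; apply is_RInt_Ein.
- apply (ex_RInt_scal (V := R_NormedModule) (fun t => (exp (- t) - 1) / - t)).
  apply (ex_RInt_ext (fun t => opp (opp ((exp (- t) - 1) / - t))));
    [intros t _; apply (opp_opp (G := R_AbelianGroup)) |].
  apply (ex_RInt_opp (V := R_NormedModule) (fun t => opp ((exp (- t) - 1) / - t))).
  apply (ex_RInt_comp_opp (V := R_NormedModule) (fun t => (exp t - 1) / t)).
  rewrite Ropp_0; eexists; apply is_RInt_Ein.
Qed.

(** The logarithms and Euler's constant cancel, and (cosh t - 1) / t + sinh t / t = (e^t - 1) /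
    t. *)
Lemma bracket_Ein (z : R) : bracket z = - Ein z / z.
Proof.
assert (Hnz : forall t, Rmin 0 z < t < Rmax 0 z -> t <> 0).
{ intros t Ht E; rewrite E in Ht.
  unfold Rmin, Rmax in Ht; destruct (Rle_dec 0 z); lra. }
assert (Hs : ex_RInt (fun t => sinh t / t) 0 z).
{ apply (ex_RInt_ext (fun t => / 2 * ((exp t - 1) / t)
                               + / 2 * ((exp (- t) - 1) / (- t)))).
  - intros t Ht; unfold sinh; match goal with |- ?a = ?b => change (@eq R a b) end.
    field; apply Hnz, Ht.
  - apply ex_RInt_expm1_comb. }
assert (Hc : ex_RInt (fun t => (cosh t - 1) / t) 0 z).
{ apply (ex_RInt_ext (fun t => / 2 * ((exp t - 1) / t)
                               + - / 2 * ((exp (- t) - 1) / (- t)))).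
  - intros t Ht; unfold cosh; match goal with |- ?a = ?b => change (@eq R a b) end.
    field; apply Hnz, Ht.
  - apply ex_RInt_expm1_comb. }
assert (H : RInt (fun t => (cosh t - 1) / t) 0 z + RInt (fun t => sinh t / t) 0 z
            = Ein z).
{ rewrite <- (is_RInt_unique _ _ _ _ (is_RInt_Ein z)).
  symmetry; apply is_RInt_unique.
  apply (is_RInt_ext (fun t => plus ((cosh t - 1) / t) (sinh t / t))).
  - intros t Ht; unfold plus; simpl; unfold cosh, sinh.
    match goal with |- ?a = ?b => change (@eq R a b) end; field; apply Hnz, Ht.
  - apply (is_RInt_plus (V := R_NormedModule));
      apply (RInt_correct (V := R_CompleteNormedModule)); assumption. }
unfold bracket, Chi, Shi; rewrite <- H; unfold Rdiv; ring.
Qed.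

Lemma bracket_egf (z : R) :
  z <> 0 -> bracket z = egf (fun n => - (/ INR (S n) / INR (S n))) z.
Proof.
intros Hz; rewrite bracket_Ein; unfold Ein.
rewrite egf_decr by apply entire_inv_INR; simpl (INR 0); rewrite Rinv_0.
rewrite Rplus_0_l.
replace (egf (fun n => - (/ INR (S n) / INR (S n))) z)
  with (- egf (fun n => / INR (S n) / INR (S n)) z).
- field; exact Hz.
- unfold egf; rewrite <- PSeries_opp; apply PSeries_ext; intros n.
  unfold PS_opp, opp; simpl; unfold Rdiv; ring.
Qed.

Lemma entire_bracket :
  entire (fun n => - (/ INR (S n) / INR (S n)) / INR (fact n)).
Proof.
apply entire_egf_bounded; intros n.
destruct (Rinv_INR_S_bound n); rewrite Rabs_Ropp.
unfold Rdiv; rewrite Rabs_pos_eq; nra.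
Qed.

(** Near a nonzero point [bracket] coincides with an entire series, so each [Derive_n] is there a
    true derivative and not a default value. *)
Lemma derivative_chain_bracket : derivative_chain (fun k => Derive_n bracket k).
Proof.
intros k z Hz; apply Derive_correct.
set (f := egf (fun n => - (/ INR (S n) / INR (S n)))).
apply (ex_derive_ext_loc (Derive_n f k)).
- apply (filter_imp (fun y => y <> 0)); [intros y Hy | apply locally_neq_0, Hz].
  apply Derive_n_ext_loc.
  apply (filter_imp (fun y => y <> 0)); [| apply locally_neq_0, Hy].
  intros t Ht; symmetry; apply bracket_egf, Ht.
- apply (ex_derive_n_PSeries (S k)), entire_inside, entire_bracket.
Qed.

(* [exp (- y) * egf harmonic y] and [- Ein (- y)] have the same derivative
   [(1 - exp (- y)) / y]. *)
Lemma harmonic_egf (x : R) : egf harmonic x = - exp x * Ein (- x).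
Proof.
set (f := fun y => exp (- y) * egf harmonic y + Ein (- y)).
assert (Hd : forall y, is_derive f y 0).
{ intros y.
  assert (Hh := is_derive_egf harmonic y entire_harmonic).
  assert (HE : is_derive (fun y => Ein (- y)) y (- egf (fun n => / INR (S n)) (- y))).
  { replace (- egf (fun n => / INR (S n)) (- y))
      with (scal (-1) (egf (fun n => / INR (S n)) (- y)))
      by (unfold scal; simpl; unfold mult; simpl; ring).
    apply (is_derive_comp Ein Ropp); [apply is_derive_Ein |].
    auto_derive; [exact I | reflexivity]. }
  assert (He : is_derive (fun y => exp (- y)) y (- exp (- y)))
    by (auto_derive; [exact I | ring]).
  assert (Hm := is_derive_mult (fun y => exp (- y)) (egf harmonic) y _ _ He Hh
                  (fun n m => Rmult_comm n m)).
  assert (Hp := is_derive_plus (V := R_NormedModule) _ _ y _ _ Hm HE).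
  replace 0 with (plus (plus (mult (- exp (- y)) (egf harmonic y))
                    (mult (exp (- y)) (egf (fun n => harmonic (S n)) y)))
                    (- egf (fun n => / INR (S n)) (- y))); [exact Hp |].
  unfold plus, mult; simpl.
  rewrite (egf_ext (fun n => harmonic (S n)) (fun n => 1 * harmonic n + 1 * / INR (S n)))
    by (intros n; rewrite harmonic_S; ring).
  rewrite egf_linear by (apply entire_harmonic || apply entire_inv_INR_S).
  destruct (Req_dec y 0) as [-> | Hy].
  - rewrite Ropp_0, exp_0, !egf_0; simpl; field.
  - rewrite !egf_inv_INR_S by lra.
    assert (exp (- y) * exp y = 1) by (rewrite <- exp_plus, Rplus_opp_l; apply exp_0).
    replace (exp y) with (/ exp (- y)) by (rewrite exp_Ropp, Rinv_inv; reflexivity).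
    field; split; [exact Hy | apply Rgt_not_eq, exp_pos]. }
destruct (MVT_gen f 0 x (fun _ => 0)) as [c [_ Hc]].
- intros y _; apply Hd.
- intros y _; apply continuity_pt_filterlim.
  apply (ex_derive_continuous (V := R_NormedModule)); eexists; apply Hd.
- assert (Hf : f x = 0).
  { replace (f x) with (f 0) by lra.
    unfold f; rewrite Ropp_0, Ein_0, egf_0, harmonic_0; ring. }
  unfold f in Hf; rewrite exp_Ropp in Hf.
  pose proof (exp_pos x).
  replace (Ein (- x)) with (- (/ exp x * egf harmonic x)) by lra.
  field; lra.
Qed.

(** * Closed forms of the two transforms *)

(** The [k]-th derivative of [- 1 / z]. *)
Definition inv_deriv (k : nat) (z : R) : R := INR (fact k) / (- z) ^ S k.

Lemma derivative_chain_inv : derivative_chain inv_deriv.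
Proof.
intros k z Hz; unfold inv_deriv.
assert (Hp : (- z) ^ k <> 0) by (apply pow_nonzero; lra).
auto_derive.
- simpl; nra.
- rewrite INR_fact_S.
  rewrite <- !tech_pow_Rmult; simpl Nat.pred.
  change (match k with 0%nat => 1 | S _ => INR k + 1 end) with (INR (S k)).
  field; split; [| lra]; exact Hp.
Qed.

(** The summands are the contributions of the endpoints t = 1 and t = 0 to repeated integration by
    parts. For [p = m = 0] they are e^x / x and - 1 / x. *)
Lemma beta_transform (p m : nat) (x : R) : x <> 0 ->
  egf (fun n => beta_int (p + n) m) x =
  exp x * alt_binomial p (fun n => inv_deriv (n + m) (- x))
  + alt_binomial m (fun n => inv_deriv (n + p) x).
Proof.
intros Hx.
apply (contiguous_unique (fun p m => egf (fun n => beta_int (p + n) m))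
  (fun p m x => exp x * alt_binomial p (fun n => inv_deriv (n + m) (- x))
  + alt_binomial m (fun n => inv_deriv (n + p) x))); [| | | exact Hx].
- apply contiguous_egf; [apply beta_int_contiguous | apply beta_int_0_r_bound].
- apply contiguous_plus.
  + apply (contiguous_exp_alt_binomial inv_deriv), derivative_chain_inv.
  + apply (contiguous_alt_binomial inv_deriv), derivative_chain_inv.
- clear x Hx p m; intros x Hx.
  rewrite (egf_ext (fun n => beta_int (0 + n) 0) (fun n => / INR (S n)))
    by (intros n; apply beta_int_0_r).
  rewrite egf_inv_INR_S by exact Hx.
  unfold alt_binomial; rewrite !sum_O, !C_n_0; unfold inv_deriv; simpl.
  field; exact Hx.
Qed.

(** For [p = m = 0] the coefficients are - H_(n+1) / (n+1), so the transform is minus the generating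
    function of H_n divided by x, which [harmonic_egf] evaluates. *)
Lemma log_beta_transform (p m : nat) (x : R) : x <> 0 ->
  egf (fun n => log_beta_int (p + n) m) x =
  exp x * alt_binomial p (fun n => Derive_n bracket (n + m) (- x)).
Proof.
intros Hx.
apply (contiguous_unique (fun p m => egf (fun n => log_beta_int (p + n) m))
  (fun p m x => exp x * alt_binomial p (fun n => Derive_n bracket (n + m) (- x))));
  [| | | exact Hx].
- apply contiguous_egf; [apply log_beta_int_contiguous | apply log_beta_int_0_r_bound].
- apply (contiguous_exp_alt_binomial (fun k => Derive_n bracket k)),
    derivative_chain_bracket.
- clear x Hx p m; intros x Hx.
  unfold alt_binomial; rewrite sum_O, C_n_0; simpl.
  rewrite bracket_Ein.
  replace (exp x * (1 * 1 * (- Ein (- x) / - x)))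
    with (- (- exp x * Ein (- x)) / x) by (field; exact Hx).
  rewrite <- harmonic_egf, (egf_decr harmonic) by apply entire_harmonic.
  rewrite harmonic_0, Rplus_0_l.
  replace (- (x * egf (fun n => harmonic (S n) / INR (S n)) x) / x)
    with (- egf (fun n => harmonic (S n) / INR (S n)) x) by (field; exact Hx).
  unfold egf; rewrite <- PSeries_opp; apply PSeries_ext; intros n.
  rewrite log_beta_int_0_r; unfold PS_opp, opp; simpl; unfold Rdiv; ring.
Qed.

(** * Termwise differentiation in a parameter *)

(** Quadratic remainder bounds for the terms, with summable constants [K], add up to a quadratic
    remainder bound for the sum. *)
Lemma is_derive_Series (u : nat -> R -> R) (d K : nat -> R) (b r : R) :
  0 < r ->
  (forall n h, Rabs h < r -> Rabs (u n (b + h) - u n b - h * d n) <= h ^ 2 * K n) ->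
  (forall h, Rabs h < r -> ex_series (fun n => u n (b + h))) ->
  ex_series d -> ex_series K ->
  is_derive (fun y => Series (fun n => u n y)) b (Series d).
Proof.
intros Hr Hu Hex Hd HK.
assert (Hub : ex_series (fun n => u n b)).
{ assert (H0 : Rabs 0 < r) by (rewrite Rabs_R0; exact Hr).
  apply ex_series_ext with (2 := Hex 0 H0); intros n; rewrite Rplus_0_r; reflexivity. }
assert (Hest : forall h, Rabs h < r ->
  Rabs (Series (fun n => u n (b + h)) - Series (fun n => u n b) - h * Series d)
  <= h ^ 2 * Series K).
{ intros h Hh.
  rewrite <- Series_scal_l, <- Series_scal_l.
  rewrite <- Series_minus by (apply Hex || assumption; assumption).
  assert (Hhd : ex_series (fun n => h * d n))
    by apply (ex_series_scal_l (K := R_AbsRing) h d Hd).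
  assert (HhK : ex_series (fun n => h ^ 2 * K n))
    by apply (ex_series_scal_l (K := R_AbsRing) (h ^ 2) K HK).
  assert (Hm : ex_series (fun n => u n (b + h) - u n b))
    by apply (ex_series_minus (V := R_NormedModule) _ _ (Hex h Hh) Hub).
  rewrite <- Series_minus by assumption.
  eapply Rle_trans; [apply Series_Rabs |].
  - apply (ex_series_le (K := R_AbsRing) (V := R_CompleteNormedModule) _
             (fun n => h ^ 2 * K n)); [| exact HhK].
    intros n; unfold norm; simpl; unfold abs; simpl.
    rewrite Rabs_Rabsolu; apply Hu, Hh.
  - apply Series_le; [| exact HhK].
    intros n; split; [apply Rabs_pos | apply Hu, Hh]. }
apply is_derive_Reals; intros eps Heps.
pose proof (Rabs_pos (Series K)) as HKpos.
(* The difference quotient errs by at most |h| times [Series K]; the added 1 keeps the denominator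
   positive. *)
assert (Hdelta : 0 < Rmin r (eps / (Rabs (Series K) + 1))).
{ apply Rmin_pos; [exact Hr | apply Rdiv_lt_0_compat; lra]. }
exists (mkposreal _ Hdelta); simpl; intros h Hh0 Hh.
assert (Hhr : Rabs h < r) by (eapply Rlt_le_trans; [exact Hh | apply Rmin_l]).
assert (Hhe : Rabs h * (Rabs (Series K) + 1) < eps).
{ apply Rlt_div_r; [lra |]; eapply Rlt_le_trans; [exact Hh | apply Rmin_r]. }
pose proof (Rabs_pos_lt h Hh0) as Hhpos.
set (D := Series (fun n => u n (b + h)) - Series (fun n => u n b)) in *.
replace (D / h - Series d) with ((D - h * Series d) / h) by (field; exact Hh0).
rewrite Rabs_div by exact Hh0; apply Rlt_div_l; [exact Hhpos |].
eapply Rle_lt_trans; [apply Hest, Hhr |].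
rewrite <- pow2_abs; pose proof (Rle_abs (Series K)).
apply Rle_lt_trans with (Rabs h * (Rabs h * (Rabs (Series K) + 1))); [| nra].
rewrite <- Rmult_assoc; simpl; rewrite Rmult_1_r.
apply Rmult_le_compat_l; [nra | lra].
Qed.

(** * Inverse Pochhammer symbols and the derivative of the Kummer series *)

(** In terms of the digamma function this is psi(b + n) - psi(b). *)
Fixpoint recip_sum (b : R) (n : nat) : R :=
  match n with
  | O => 0
  | S p => recip_sum b p + / (b + INR p)
  end.

Lemma inv_le (x y : R) : 0 < x -> x <= y -> 0 <= / y <= / x.
Proof.
intros Hx Hxy; split; [left; apply Rinv_0_lt_compat; lra | apply Rinv_le_contravar; lra].
Qed.

Lemma pochhammer_ge_fact (b : R) (n : nat) :
  1 <= b -> INR (fact n) <= pochhammer b n.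
Proof.
intros Hb; induction n as [|n IH]; [simpl; lra |].
rewrite INR_fact_S, S_INR; simpl pochhammer.
pose proof (pos_INR n); pose proof (INR_fact_lt_0 n); nra.
Qed.

Lemma inv_pochhammer_bound (b : R) (n : nat) :
  1 <= b -> 0 <= / pochhammer b n <= / INR (fact n).
Proof. intros Hb; apply inv_le; [apply INR_fact_lt_0 | apply pochhammer_ge_fact, Hb]. Qed.

Lemma Rabs_mult_le (u v U V : R) : Rabs u <= U -> Rabs v <= V -> Rabs (u * v) <= U * V.
Proof. intros; rewrite Rabs_mult; apply Rmult_le_compat; auto using Rabs_pos. Qed.

Lemma Rabs_le_pos (u U : R) : 0 <= u <= U -> Rabs u <= U.
Proof. intros [H H']; rewrite Rabs_pos_eq; assumption. Qed.

(** This first-order estimate controls the cross term of the second-order one. Each new factor is at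
    most 1/(n+1), and its own variation adds one to the count [INR n]. *)
Lemma inv_pochhammer_lipschitz (b c : R) (n : nat) : 1 <= b -> 1 <= c ->
  Rabs (/ pochhammer c n - / pochhammer b n) <= Rabs (c - b) * (INR n / INR (fact n)).
Proof.
intros Hb Hc; induction n as [|n IH].
{ simpl; rewrite Rminus_diag, Rabs_R0; lra. }
simpl pochhammer; rewrite !Rinv_mult, INR_fact_S.
pose proof (pos_INR n) as Hn.
pose proof (Rabs_le_pos _ _ (inv_pochhammer_bound b n Hb)) as HQ.
set (P := / pochhammer c n) in *; set (Q := / pochhammer b n) in *.
unfold Rdiv in *; rewrite Rinv_mult.
pose proof (Rinv_0_lt_compat _ (INR_fact_lt_0 n)) as HFpos.
set (F := / INR (fact n)) in *.
assert (HBn : Rabs (/ (b + INR n)) <= / INR (S n))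
  by (apply Rabs_le_pos, inv_le; rewrite ?S_INR; lra).
assert (HCn : Rabs (/ (c + INR n)) <= / INR (S n))
  by (apply Rabs_le_pos, inv_le; rewrite ?S_INR; lra).
replace (P * / (c + INR n) - Q * / (b + INR n))
  with ((P - Q) * / (c + INR n) + - (Q * ((c - b) * / (c + INR n)) * / (b + INR n)))
  by (field; lra).
eapply Rle_trans; [apply Rabs_triang |]; rewrite Rabs_Ropp.
pose proof (Rabs_mult_le _ _ _ _ IH HCn) as H1.
pose proof (Rabs_mult_le _ _ _ _ (Rabs_mult_le _ _ _ _ HQ
  (Rabs_mult_le _ _ _ _ (Rle_refl (Rabs (c - b))) HCn)) HBn) as H2.
destruct (Rinv_INR_S_bound n) as [HN0 HN1].
set (N := / INR (S n)) in *.
pose proof (Rabs_pos (c - b)) as Hcb.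
rewrite S_INR.
assert (F * (Rabs (c - b) * N) * N <= F * (Rabs (c - b) * N) * 1).
{ apply Rmult_le_compat_l; [| exact HN1].
  apply Rmult_le_pos; [lra | apply Rmult_le_pos; assumption]. }
lra.
Qed.

(* The logarithmic derivative of [1 / (b)_n] is [- recip_sum b n]. *)
Lemma inv_pochhammer_taylor (b c : R) (n : nat) : 1 <= b -> 1 <= c ->
  Rabs (/ pochhammer c n - / pochhammer b n
        + (c - b) * (recip_sum b n * / pochhammer b n))
  <= (c - b) ^ 2 * (INR n ^ 2 / INR (fact n)).
Proof.
intros Hb Hc; induction n as [|n IH].
{ simpl; rewrite Rmult_0_l, Rmult_0_r, Rminus_diag, Rplus_0_r, Rabs_R0.
  lra. }
pose proof (inv_pochhammer_lipschitz b c n Hb Hc) as HL.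
simpl pochhammer; simpl recip_sum; rewrite !Rinv_mult, INR_fact_S.
pose proof (pos_INR n) as Hn.
pose proof (Rabs_le_pos _ _ (inv_pochhammer_bound b n Hb)) as HQ.
set (P := / pochhammer c n) in *; set (Q := / pochhammer b n) in *.
set (s := recip_sum b n) in *.
unfold Rdiv in *; rewrite Rinv_mult.
pose proof (Rinv_0_lt_compat _ (INR_fact_lt_0 n)) as HFpos.
set (F := / INR (fact n)) in *.
assert (HBn : Rabs (/ (b + INR n)) <= / INR (S n))
  by (apply Rabs_le_pos, inv_le; rewrite ?S_INR; lra).
assert (HCn : Rabs (/ (c + INR n)) <= / INR (S n))
  by (apply Rabs_le_pos, inv_le; rewrite ?S_INR; lra).
(* The three parts are the old remainder times the new factor, the cross term handled by the
   Lipschitz estimate, and the second-order remainder of 1/(b + n). *)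
replace (_ + _) with
  ((P - Q + (c - b) * (s * Q)) * / (b + INR n)
   + (- ((c - b) * (P - Q) * (/ (b + INR n) * / (c + INR n)))
      + (c - b) ^ 2 * (Q * (/ (b + INR n) * / (b + INR n)) * / (c + INR n))))
  by (field; lra).
eapply Rle_trans; [apply Rabs_triang |].
eapply Rle_trans; [apply Rplus_le_compat_l, Rabs_triang |]; rewrite Rabs_Ropp.
pose proof (Rabs_mult_le _ _ _ _ IH HBn) as H1.
pose proof (Rabs_mult_le _ _ _ _
  (Rabs_mult_le _ _ _ _ (Rle_refl (Rabs (c - b))) HL)
  (Rabs_mult_le _ _ _ _ HBn HCn)) as H2.
pose proof (Rabs_mult_le ((c - b) ^ 2) _ ((c - b) ^ 2) _
  (Rabs_le_pos _ _ (conj (pow2_ge_0 _) (Rle_refl _)))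
  (Rabs_mult_le _ _ _ _ (Rabs_mult_le _ _ _ _ HQ (Rabs_mult_le _ _ _ _ HBn HBn)) HCn))
  as H3.
destruct (Rinv_INR_S_bound n) as [HN0 HN1].
set (N := / INR (S n)) in *.
rewrite <- (pow2_abs (c - b)) in *.
set (h := Rabs (c - b)) in *.
assert (Hh : 0 <= h) by apply Rabs_pos.
assert (HW : 0 <= h ^ 2 * F * N)
  by (apply Rmult_le_pos; [apply Rmult_le_pos; [apply pow2_ge_0 | lra] | exact HN0]).
assert (E2 : h * (h * (INR n * F)) * (N * N) <= h ^ 2 * F * N * INR n).
{ replace (h * (h * (INR n * F)) * (N * N)) with (h ^ 2 * F * N * INR n * N) by ring.
  rewrite <- (Rmult_1_r (h ^ 2 * F * N * INR n)) at 2.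
  apply Rmult_le_compat_l; [apply Rmult_le_pos; assumption | exact HN1]. }
assert (E3 : h ^ 2 * (F * (N * N) * N) <= h ^ 2 * F * N).
{ replace (h ^ 2 * (F * (N * N) * N)) with (h ^ 2 * F * N * (N * N)) by ring.
  rewrite <- (Rmult_1_r (h ^ 2 * F * N)) at 2.
  apply Rmult_le_compat_l; [exact HW | nra]. }
rewrite S_INR.
(* In (n+1)^2 = n^2 + 2n + 1 the three parts take n^2, n and 1, which leaves n as slack. *)
replace (h ^ 2 * ((INR n + 1) ^ 2 * (N * F)))
  with (h ^ 2 * (INR n ^ 2 * F) * N + 2 * (h ^ 2 * F * N * INR n) + h ^ 2 * F * N) by ring.
pose proof (Rmult_le_pos _ _ HW Hn); lra.
Qed.

Lemma recip_sum_bound (b : R) (n : nat) : 1 <= b -> 0 <= recip_sum b n <= INR n.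
Proof.
intros Hb; induction n as [|n IH]; [simpl; lra |].
rewrite S_INR; simpl recip_sum; pose proof (pos_INR n).
pose proof (inv_le 1 (b + INR n) ltac:(lra) ltac:(lra)) as H1.
rewrite Rinv_1 in H1; lra.
Qed.

(** Each factor satisfies |a + k| <= (k + 1)(1 + |a|). *)
Lemma pochhammer_bound (a : R) (n : nat) :
  Rabs (pochhammer a n) <= INR (fact n) * (1 + Rabs a) ^ n.
Proof.
induction n as [|n IH]; [simpl; rewrite Rabs_R1; lra |].
rewrite INR_fact_S; simpl pochhammer.
replace (INR (S n) * INR (fact n) * (1 + Rabs a) ^ S n) with
  (INR (fact n) * (1 + Rabs a) ^ n * (INR (S n) * (1 + Rabs a))) by (simpl; ring).
apply Rabs_mult_le; [exact IH |].
eapply Rle_trans; [apply Rabs_triang |].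
rewrite (Rabs_pos_eq (INR n)), S_INR by apply pos_INR.
pose proof (pos_INR n); pose proof (Rabs_pos a); nra.
Qed.

Lemma is_derive_kummer (a b x : R) : 1 < b ->
  is_derive (fun b' => kummer a b' x) b
    (egf (fun n => - (pochhammer a n * (recip_sum b n * / pochhammer b n))) x).
Proof.
intros Hb.
(* The n! that bounds (a)_n cancels the 1/n! of the series, so all decay must come from [v], the
   part built from 1/(b)_n. *)
assert (Hdom : forall n v B, Rabs v <= B ->
  Rabs (pochhammer a n * v * / INR (fact n) * x ^ n)
  <= B * ((1 + Rabs a) * Rabs x) ^ n).
{ intros n v B Hv.
  rewrite Rpow_mult_distr.
  replace (B * ((1 + Rabs a) ^ n * Rabs x ^ n)) with
    (INR (fact n) * (1 + Rabs a) ^ n * B * / INR (fact n) * Rabs x ^ n)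
    by (field; apply INR_fact_neq_0).
  repeat apply Rabs_mult_le; [apply pochhammer_bound | exact Hv | |].
  - rewrite Rabs_pos_eq; [lra |]; left; apply Rinv_0_lt_compat, INR_fact_lt_0.
  - rewrite RPow_abs; lra. }
set (M := (1 + Rabs a) * Rabs x) in *.
assert (HM : 0 <= M).
{ apply Rmult_le_pos; [pose proof (Rabs_pos a); lra | apply Rabs_pos]. }
(* Since n <= 2^n, the factor n^k is absorbed into the base of an exponential series. The values k =
   0, 1, 2 serve the terms, their derivatives and the remainders. *)
assert (Hterm : forall k n,
  INR n ^ k / INR (fact n) * M ^ n <= 1 * ((2 ^ k * M) ^ n / INR (fact n))).
{ intros k n; rewrite Rpow_mult_distr, <- pow_mult, (Nat.mul_comm k n), pow_mult.
  rewrite Rmult_1_l; unfold Rdiv.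
  replace (INR n ^ k * / INR (fact n) * M ^ n)
    with (INR n ^ k * (M ^ n * / INR (fact n))) by ring.
  rewrite (Rmult_assoc ((2 ^ n) ^ k)).
  apply Rmult_le_compat_r.
  - apply Rmult_le_pos; [apply pow_le, HM |].
    left; apply Rinv_0_lt_compat, INR_fact_lt_0.
  - apply pow_incr; split; [apply pos_INR | apply INR_le_pow2]. }
set (K := fun n : nat => INR n ^ 2 / INR (fact n) * M ^ n).
assert (Hpos : forall k n, 0 <= INR n ^ k / INR (fact n) * M ^ n).
{ intros k n; apply Rmult_le_pos; [| apply pow_le, HM].
  apply Rdiv_le_0_compat; [apply pow_le, pos_INR | apply INR_fact_lt_0]. }
apply (is_derive_ext
  (fun b' => Series (fun n => pochhammer a n * / pochhammer b' n * / INR (fact n) * x ^ n))).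
{ intros b'; apply Series_ext; intros n; unfold Rdiv; rewrite Rinv_mult; ring. }
unfold egf, PSeries.
rewrite (Series_ext _ (fun n =>
  pochhammer a n * (- (recip_sum b n * / pochhammer b n)) * / INR (fact n) * x ^ n))
  by (intros n; unfold Rdiv; ring).
(* The radius b - 1 keeps b + h above 1, where the Pochhammer bounds apply. *)
apply (is_derive_Series _ _ K b (b - 1)).
- lra.
- intros n h Hh; apply Rabs_def2 in Hh.
  replace (_ - _ - _) with
    (pochhammer a n * (/ pochhammer (b + h) n - / pochhammer b n
        + (b + h - b) * (recip_sum b n * / pochhammer b n)) * / INR (fact n) * x ^ n)
    by ring.
  unfold K.
  replace (h ^ 2 * (INR n ^ 2 / INR (fact n) * M ^ n))
    with ((b + h - b) ^ 2 * (INR n ^ 2 / INR (fact n)) * M ^ n) by ring.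
  apply Hdom, inv_pochhammer_taylor; lra.
- intros h Hh; apply Rabs_def2 in Hh.
  apply (ex_series_exp_dominated _ 1 (2 ^ 0 * M)); intros n.
  eapply Rle_trans; [| apply (Hterm 0%nat n)].
  apply Hdom, Rabs_le_pos; simpl; unfold Rdiv; rewrite Rmult_1_l.
  apply inv_pochhammer_bound; lra.
- apply (ex_series_exp_dominated _ 1 (2 ^ 1 * M)); intros n.
  eapply Rle_trans; [| apply (Hterm 1%nat n)].
  apply Hdom; rewrite Rabs_Ropp, pow_1.
  apply Rabs_mult_le; apply Rabs_le_pos;
    [apply recip_sum_bound | apply inv_pochhammer_bound]; lra.
- apply (ex_series_exp_dominated _ 1 (2 ^ 2 * M)); intros n.
  rewrite Rabs_pos_eq by apply Hpos; apply Hterm.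
Qed.

(** * Integer parameters and assembly of the formula *)

Lemma pochhammer_INR (p n : nat) :
  pochhammer (INR (S p)) n = INR (fact (p + n)) / INR (fact p).
Proof.
induction n as [|n IH].
- rewrite Nat.add_0_r; simpl pochhammer; field; apply INR_fact_neq_0.
- change (pochhammer _ (S n)) with (pochhammer (INR (S p)) n * (INR (S p) + INR n)).
  rewrite IH, Nat.add_succ_r, INR_fact_S.
  rewrite !S_INR, plus_INR; field; apply INR_fact_neq_0.
Qed.

Lemma recip_sum_INR (p n : nat) :
  recip_sum (INR (S p)) n = harmonic (p + n) - harmonic p.
Proof.
induction n as [|n IH]; [rewrite Nat.add_0_r; simpl; ring |].
change (recip_sum _ (S n)) with (recip_sum (INR (S p)) n + / (INR (S p) + INR n)).
rewrite IH, Nat.add_succ_r, harmonic_S, !S_INR, plus_INR.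
replace (INR p + 1 + INR n) with (INR p + INR n + 1) by ring; ring.
Qed.

(** Here (p+1)_n / (p+m+2)_n is the constant factor times [beta_int (p + n) m]. Inserting H_m into
    H_(p+m+1) - H_(p+m+n+1) separates the plain moment from the logarithmic one. *)
Lemma kummer_derivative_egf (p m : nat) (x : R) :
  egf (fun n => - (pochhammer (INR (S p)) n *
         (recip_sum (INR (S (S (p + m)))) n * / pochhammer (INR (S (S (p + m)))) n))) x =
  INR (S (p + m)) * Binomial.C (p + m) m *
  ((harmonic (S (p + m)) - harmonic m) * egf (fun n => beta_int (p + n) m) x
   + egf (fun n => log_beta_int (p + n) m) x).
Proof.
set (c := INR (S (p + m)) * Binomial.C (p + m) m).
rewrite Rmult_plus_distr_l, <- Rmult_assoc, <- egf_linear.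
- apply egf_ext; intros n.
  rewrite !pochhammer_INR, recip_sum_INR.
  unfold c, log_beta_int, beta_int, Binomial.C; rewrite Nat.add_sub.
  replace (S (p + n + m)) with (S (p + m) + n)%nat by lia.
  rewrite (INR_fact_S (p + m)).
  field; repeat split; first [apply INR_fact_neq_0 | apply not_0_INR; lia].
- apply (entire_contiguous_weight beta_int);
    [apply beta_int_contiguous | apply beta_int_0_r_bound].
- apply (entire_contiguous_weight log_beta_int);
    [apply log_beta_int_contiguous | apply log_beta_int_0_r_bound].
Qed.

(** Reversing the order of summation, n to p - n, turns the falling powers of 1/z into the
    polynomial [calP] over a common denominator. *)
Lemma alt_binomial_inv_deriv (p q : nat) (z : R) : z <> 0 ->
  alt_binomial p (fun n => inv_deriv (n + q) z) =
  (-1) ^ p / (- z) ^ S (p + q) * calP (Z.of_nat p - Z.of_nat q) p z.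
Proof.
intros Hz; unfold alt_binomial, calP.
rewrite sum_n_Reals, <- sum_f_R0_skip, <- sum_n_Reals.
apply eq_trans with (sum_n (fun n => mult ((-1) ^ p / (- z) ^ S (p + q) : R_Ring)
  (Binomial.C p n
   * INR (fact (Z.to_nat (2 * Z.of_nat p - (Z.of_nat p - Z.of_nat q) - Z.of_nat n)))
   * z ^ n)) p).
- apply sum_n_ext_loc; intros n Hn.
  rewrite <- pascal_step1 by exact Hn.
  replace (Z.to_nat _) with (p - n + q)%nat by lia.
  unfold inv_deriv.
  assert (Hzn : (- z) ^ n <> 0) by (apply pow_nonzero; lra).
  assert (Hzk : (- z) ^ S (p - n + q) <> 0) by (apply pow_nonzero; lra).
  replace (S (p + q)) with (n + S (p - n + q))%nat by lia.
  replace ((-1) ^ p) with ((-1) ^ n * (-1) ^ (p - n)) by (rewrite <- pow_add; f_equal; lia).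
  rewrite pow_add.
  replace (z ^ n) with ((-1) ^ n * (- z) ^ n) by (rewrite <- Rpow_mult_distr; f_equal; ring).
  assert (Hs : (-1) ^ n * (-1) ^ n = 1)
    by (rewrite <- Rpow_mult_distr; replace (-1 * -1) with 1 by ring; apply pow1).
  set (e := (-1) ^ n) in *.
  match goal with |- ?a = ?b => change (@eq R a b) end.
  (* The square of the sign is inserted by hand, as [field] sees [e] as an atom. *)
  transitivity (e * e * ((-1) ^ (p - n) * Binomial.C p n
     * (INR (fact (p - n + q)) / (- z) ^ S (p - n + q)))); [rewrite Hs; ring |].
  set (d := (- z) ^ S (p - n + q)) in *; unfold mult; simpl.
  field; split; assumption.
- rewrite sum_n_mult_l; reflexivity.
Qed.

Lemma calF_alt_binomial (p m : nat) (z : R) :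
  calF (Z.of_nat p - Z.of_nat m) p z =
  alt_binomial p (fun n => Derive_n bracket (n + m) z).
Proof.
apply sum_n_ext; intros n; do 2 f_equal; lia.
Qed.

(** The first conjunct ensures that the [Derive] inside [H1] is a genuine derivative and not a
    default value. *)
Theorem corollary25 (l : Z) (m : nat) (hlm : (l <= Z.of_nat m)%Z)
    (x : R) (hx : x <> 0) :
  ex_derive (fun b => kummer (IZR (Z.of_nat m + 1 - l)) b x)
    (IZR (2 * (Z.of_nat m + 1) - l)) /\
  H1 (IZR (Z.of_nat m + 1 - l)) (IZR (2 * (Z.of_nat m + 1) - l)) x =
    IZR (2 * Z.of_nat m - l + 1) * Binomial.C (Z.to_nat (2 * Z.of_nat m - l)) m *
    (powerRZ (-1) (Z.of_nat m - l) * powerRZ x (l - 2 * Z.of_nat m - 1) *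
       (harmonic (Z.to_nat (2 * Z.of_nat m - l + 1)) - harmonic m) *
       (exp x * calP (- l) (Z.to_nat (Z.of_nat m - l)) (- x) - calP l m x)
     + exp x * calF (- l) (Z.to_nat (Z.of_nat m - l)) (- x)).
Proof.
(* With p = m - l as a natural number, every integer expression becomes the image of a natural
   number, its negative or a difference of two. *)
set (p := Z.to_nat (Z.of_nat m - l)).
assert (Hp : l = (Z.of_nat m - Z.of_nat p)%Z) by (unfold p; lia).
clearbody p; subst l; clear hlm.
replace (Z.of_nat m + 1 - (Z.of_nat m - Z.of_nat p))%Z with (Z.of_nat (S p)) by lia.
replace (2 * (Z.of_nat m + 1) - (Z.of_nat m - Z.of_nat p))%Z
  with (Z.of_nat (S (S (p + m)))) by lia.
replace (2 * Z.of_nat m - (Z.of_nat m - Z.of_nat p) + 1)%Z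
  with (Z.of_nat (S (p + m))) by lia.
replace (2 * Z.of_nat m - (Z.of_nat m - Z.of_nat p))%Z with (Z.of_nat (p + m)) by lia.
replace (Z.of_nat m - (Z.of_nat m - Z.of_nat p))%Z with (Z.of_nat p) by lia.
replace (Z.of_nat m - Z.of_nat p - 2 * Z.of_nat m - 1)%Z
  with (- Z.of_nat (S (p + m)))%Z by lia.
replace (- (Z.of_nat m - Z.of_nat p))%Z with (Z.of_nat p - Z.of_nat m)%Z by lia.
rewrite powerRZ_neg', <- !pow_powerRZ, !Nat2Z.id, <- !INR_IZR_INZ.
assert (Hd := is_derive_kummer (INR (S p)) (INR (S (S (p + m)))) x).
rewrite kummer_derivative_egf, beta_transform, log_beta_transform in Hd by exact hx.
rewrite !alt_binomial_inv_deriv, <- calF_alt_binomial, Ropp_involutive in Hd by lra.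
assert (Hb : 1 < INR (S (S (p + m)))) by (rewrite !S_INR; pose proof (pos_INR (p + m)); lra).
specialize (Hd Hb).
split; [eexists; exact Hd |].
eapply eq_trans; [exact (is_derive_unique _ _ _ Hd) |].
f_equal; f_equal.
(* The t = 0 endpoint term, brought to the sign and power of the other one, supplies the minus sign
   between the two [calP]. *)
assert (Hs : (-1) ^ m / (- x) ^ S (m + p) = - ((-1) ^ p / x ^ S (p + m))).
{ assert (Hs : (-1) ^ p * (-1) ^ p = 1)
    by (rewrite <- Rpow_mult_distr; replace (-1 * -1) with 1 by ring; apply pow1).
  replace (- x) with (-1 * x) by ring.
  rewrite (Nat.add_comm m p), Rpow_mult_distr.
  change ((-1) ^ S (p + m)) with (-1 * (-1) ^ (p + m)); rewrite pow_add.
  assert (Hn : forall n, (-1) ^ n <> 0) by (intros n; apply pow_nonzero; lra).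
  assert (Hxn : x ^ S (p + m) <> 0) by (apply pow_nonzero, hx).
  set (X := x ^ S (p + m)) in *.
  replace (- ((-1) ^ p / X)) with (- ((-1) ^ p * (-1) ^ p / ((-1) ^ p * X)))
    by (field; split; [exact Hxn | apply Hn]).
  rewrite Hs; field; repeat split; auto. }
rewrite Hs; unfold Rdiv; ring.
Qed.
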